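(* Let $k$ be a field and let $V$ be a $k$-vector space spanned by two linearly independent vectors $a$ and $b$. Let $\theta : V \otimes V \to V$, $\theta(x \otimes y) = xy$, be a $k$-linear map such that $xy = yx$ for all $x, y \in V$, and such that $a^2 = b$ and $b^2 = a$. Then $(V, \theta)$ is a Jordan algebra if and only if $(V, \theta)$ is a (not necessarily unital) commutative associative algebra, i.e. $xy = yx$ and $(xy)z = x(yz)$ for all $x, y, z \in V$.
   Context: Tensor products are over the field $k$ (arbitrary), and $x^2$ denotes $xx = \theta(x \otimes x)$. A Jordan algebra over $k$ is a $k$-vector space $V$ with a $k$-linear map $\theta : V \otimes V \to V$, $\theta(x \otimes y) = xy$, such that $xy = yx$ and $(x^2 y)x = x^2(yx)$ for all $x, y \in V$. No associativity or unit is assumed of $\theta$ a priori. *)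

(* Defs.v *)
From HB Require Import structures.
From mathcomp Require Import all_boot all_order all_algebra.

Set Implicit Arguments.
Unset Strict Implicit.
Unset Printing Implicit Defensive.

Import GRing.Theory.
Local Open Scope ring_scope.

(* A k-linear map V (x) V -> V is given as the corresponding k-bilinear map. *)

Definition jordan_algebra (k : fieldType) (V : lmodType k)
    (theta : {bilinear V -> V -> V}) : Prop :=
  commutative theta /\
  forall x y : V,
    theta (theta (theta x x) y) x = theta (theta x x) (theta y x).

Definition comm_assoc_algebra (k : fieldType) (V : lmodType k)
    (theta : {bilinear V -> V -> V}) : Prop :=
  commutative theta /\ associative theta.

(* Main.v *)
Require Import Defs.
From HB Require Import structures.
From mathcomp Require Import all_boot all_order all_algebra.

(** A commutative associative product satisfies the Jordan identity at once.
    For the converse, the identity at [x = y = a] and at [x = y = b] is power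
    associativity in degree four: [((a a) a) a = (a a)(a a)], and likewise for
    [b].  Since [a a = b] and [b b = a], these two equations read
    [(b a) a = b b] and [(a b) b = a a]; up to commutativity they are the
    associativity of the triples [(b, a, a)] and [(a, b, b)].  Commutativity
    makes every triple [(x, y, x)] associative and exchanges [(x, y, z)] with
    [(z, y, x)], so all eight triples of basis vectors are covered, and the
    product is associative because the associator is trilinear
    ([bilinear_assoc_span]). *)

Set Implicit Arguments.
Unset Strict Implicit.
Unset Printing Implicit Defensive.

Import GRing.Theory.
Local Open Scope ring_scope.

Lemma span_linear_ind (k : fieldType) (V : vectType k) (s : seq V)
    (P : V -> Prop) :
    P 0 -> (forall c u v, P u -> P v -> P (c *: u + v)) ->
    {in s, forall v, P v} -> {in <<s>>%VS, forall v, P v}.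
Proof.
move=> P0 Plin Ps v /(coord_span (X := in_tuple s)) ->.
elim/big_rec: _ => [//|i w _ Pw].
by apply: Plin => //; apply: Ps; apply: mem_nth.
Qed.

(** The associator [(x y) z - x (y z)] is linear in each argument, so the
    arguments can be extended from [s] to the whole space one at a time. *)
Lemma bilinear_assoc_span (k : fieldType) (V : vectType k) (s : seq V)
    (theta : {bilinear V -> V -> V}) :
    <<s>>%VS = fullv ->
    {in s & &, forall x y z, theta x (theta y z) = theta (theta x y) z} ->
  associative theta.
Proof.
move=> span_s assoc_s x y z.
have ind (P : V -> Prop) : P 0 ->
    (forall c u v, P u -> P v -> P (c *: u + v)) ->
    {in s, forall v, P v} -> forall v, P v.
  move=> P0 Plin Ps v; apply: (span_linear_ind P0 Plin Ps).
  by rewrite span_s memvf.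
move: x; apply: (ind) => [|c u v IHu IHv|x sx].
- by rewrite !linear0l.
- by rewrite !linearPl IHu IHv.
move: y; apply: (ind) => [|c u v IHu IHv|y sy].
- by rewrite linear0l !linear0r linear0l.
- by rewrite linearPl !linearPr linearPl IHu IHv.
move: z; apply: (ind) => [|c u v IHu IHv|z sz].
- by rewrite !linear0r.
- by rewrite !linearPr IHu IHv.
exact: assoc_s.
Qed.

Theorem theorem2p1 (k : fieldType) (V : vectType k) (a b : V)
    (hfree : free [:: a; b])
    (hspan : <<[:: a; b]>>%VS = fullv)
    (theta : {bilinear V -> V -> V})
    (hcomm : forall x y : V, theta x y = theta y x)
    (haa : theta a a = b)
    (hbb : theta b b = a) :
  jordan_algebra theta <-> comm_assoc_algebra theta.
Proof.
(* The converse closes here: with [theta] associative, the Jordan identity is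
   its instance at [(x x, y, x)]. *)
split=> -[_ id_theta]; split=> //.
have baa : theta (theta b a) a = a.
  by have := id_theta a a; rewrite !haa hbb.
have abb : theta (theta a b) b = b.
  by have := id_theta b b; rewrite !hbb haa.
apply: (bilinear_assoc_span hspan) => x y z.
have flexible u v : theta u (theta v u) = theta (theta u v) u.
  by rewrite hcomm (hcomm v).
have aba : theta a (theta a b) = a by rewrite hcomm (hcomm a b).
have bab : theta b (theta b a) = b by rewrite hcomm (hcomm b a).
by rewrite !inE => /orP[]/eqP-> /orP[]/eqP-> /orP[]/eqP->;
  rewrite ?flexible // ?haa ?hbb ?haa ?baa ?abb ?aba ?bab.
Qed.
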